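(* Let $(L_n)_{n\ge 0}$ be the Lucas sequence and $\Phi=\frac{1+\sqrt5}{2}$. Every positive integer $N$ has exactly one representation $N=\sum_{i\in I}L_i$ with $I\subseteq\{0,1,2,\ldots\}$ finite, no two elements of $I$ consecutive integers, and $I$ not containing both $0$ and $2$; call the terms $L_i$, $i\in I$, the summands of the partition of $N$. For $k\ge 0$ let $Z(k)$ be the set of positive integers whose partition has $L_k$ as a summand. Then $$Z(k) = \begin{cases}\left\{2+3n+\left\lfloor\frac{n+1}{\Phi}\right\rfloor : n\ge 0\right\}, & k = 0,\\[2pt] \left\{3n+\left\lfloor\frac{n+\Phi^2}{\Phi}\right\rfloor : n\ge 0\right\}, & k = 1,\\[2pt] \left\{L_k\left\lfloor\frac{n+\Phi^2}{\Phi}\right\rfloor+ nL_{k+1}+j : n\ge 0,\ 0\le j\le L_{k-1}-1\right\}, & k \ge 2. \end{cases}$$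
   Context: The Lucas sequence is defined by $L_0=2$, $L_1=1$, and $L_n=L_{n-1}+L_{n-2}$ for $n\ge 2$. The existence and uniqueness of the representation described (non-consecutive indices, not using both $L_0$ and $L_2$) is a known fact. *)

(* Defs.v *)
From mathcomp Require Import all_boot all_order all_algebra finmap.
From mathcomp Require Import classical_sets reals.

Set Implicit Arguments.
Unset Strict Implicit.
Unset Printing Implicit Defensive.

Import Order.TTheory GRing.Theory Num.Theory.

Local Open Scope classical_set_scope.

Fixpoint lucas (n : nat) : nat :=
  match n with
  | 0 => 2
  | n'.+1 => match n' with
             | 0 => 1
             | n''.+1 => lucas n' + lucas n''
             end
  end.

Definition golden_ratio (R : realType) : R :=
  ((1 + Num.sqrt 5) / 2)%R.

Definition lucas_partition (N : nat) (I : {fset nat}) : Prop :=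
  [/\ N = \sum_(i <- I) lucas i,
      forall i : nat, ~ (i \in I /\ i.+1 \in I)
    & ~ (0 \in I /\ 2 \in I)].

                                                                          
                                              
Definition lucas_summand_set (k : nat) : set nat :=
  [set N | 0 < N /\
    exists I : {fset nat}, lucas_partition N I /\ k \in I].

(* Main.v *)
(** Write F_0 = 0, F_1 = 1, ... for the Fibonacci numbers.  If L_k is a summand
    of N, then N = j + L_k + T, where j uses the indices below k - 1 and T is a
    sum of terms L_{k+2+i} over a set Q of non-consecutive i.  Since
    L_{k+2+i} = L_k F_{i+1} + L_{k+1} F_{i+2}, one gets T = L_k h + L_{k+1} n
    with n the sum of the F_{i+2} and h the sum of the F_{i+1} over Q.  By
    Zeckendorf, n ranges over all natural numbers, and j over [0, L_{k-1})
    if k >= 2, while j = 0 if k = 1.  Finally h - n / Phi is the sum of the (1 - Phi)^{i+2}, which lies strictly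
    between 1 / Phi - 1 and 1 / Phi, so that h = floor ((n + 1) / Phi).  For
    k = 0 the index 2 is forbidden, so that the tail starts at L_3. *)

Require Import Defs.
From mathcomp Require Import all_boot all_order all_algebra finmap.
From mathcomp Require Import classical_sets reals.
From mathcomp Require Import zify ring lra.

Set Implicit Arguments.
Unset Strict Implicit.
Unset Printing Implicit Defensive.

Import Order.TTheory GRing.Theory Num.Theory.

Local Open Scope ring_scope.
Local Open Scope classical_set_scope.

(** * Fibonacci numbers and sums over bounded index sets *)

Fixpoint fib (n : nat) : nat :=
  if n is n'.+1 then (if n' is n''.+1 then fib n' + fib n'' else 1)%N else 0%N.

(* Finite index sets are encoded as boolean predicates with a bound, so that
   sums over them can be computed by recursion on the bound. *)
Definition psum (c : nat -> nat) (p : pred nat) (m : nat) : nat :=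
  (\sum_(0 <= i < m) if p i then c i else 0)%N.

Definition nonconsecutive (p : pred nat) : Prop :=
  forall i, ~~ (p i && p i.+1).

Definition lucas_admissible (p : pred nat) : Prop :=
  nonconsecutive p /\ ~~ (p 0%N && p 2%N).

Definition supported_below (p : pred nat) (m : nat) : Prop :=
  forall i, p i -> (i < m)%N.

Lemma psum0 c p : psum c p 0 = 0%N.
Proof. by rewrite /psum big_nil. Qed.

Lemma psumS c p m : psum c p m.+1 = (psum c p m + (if p m then c m else 0))%N.
Proof. by rewrite /psum big_nat_recr. Qed.

Lemma psum_addn c p a m :
  psum c p (a + m) =
  (psum c p a + psum (fun i => c (a + i)%N) (fun i => p (a + i)%N) m)%N.
Proof.
elim: m => [|m IHm]; first by rewrite addn0 psum0 addn0.
by rewrite addnS !psumS IHm addnA.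
Qed.

Lemma eq_psum c c' p p' m :
  (forall i, (i < m)%N -> p i = p' i) -> (forall i, c i = c' i) ->
  psum c p m = psum c' p' m.
Proof.
move=> pp' cc'; apply: eq_big_nat => i /andP[_ im]; by rewrite pp' // cc'.
Qed.

Lemma psum_fset c (I : {fset nat}) m :
  supported_below (mem I) m -> (\sum_(i <- I) c i)%N = psum c (mem I) m.
Proof.
move=> Im; rewrite /psum -big_mkcond -[RHS]big_filter; apply: perm_big.
apply: uniq_perm => [||i]; [exact: fset_uniq | by rewrite filter_uniq ?iota_uniq |].
rewrite mem_filter mem_index_iota /= andb_idr //; exact: Im.
Qed.

Lemma fset_supported_below (I : {fset nat}) :
  exists m, supported_below (mem I) m.
Proof.
exists (\max_(i <- I) i).+1 => i iI; rewrite ltnS.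
by rewrite (bigD1_seq i) ?leq_maxl ?fset_uniq.
Qed.

(** * Recurrences and growth of the Lucas and Fibonacci numbers *)

Lemma lucasSS n : lucas n.+2 = (lucas n.+1 + lucas n)%N.
Proof. by []. Qed.

Lemma fibSS n : fib n.+2 = (fib n.+1 + fib n)%N.
Proof. by []. Qed.

Lemma lucas_gt0 n : (0 < lucas n)%N.
Proof. by elim/ltn_ind: n => -[|[|n]] // IH; rewrite lucasSS addn_gt0 IH. Qed.

(** A crude bound that lets [N] itself bound the indices when [N] is represented. *)
Lemma ltn_lucas n : (n < lucas n.+2)%N.
Proof.
elim: n => [//|n IH]; rewrite lucasSS.
by have := lucas_gt0 n.+1; lia.
Qed.

Lemma ltn_fib n : (n < fib n.+2)%N.
Proof.
elim: n => [//|n IH]; rewrite fibSS.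
suff: (0 < fib n.+1)%N by lia.
by elim: {IH} n => [//|n IH]; rewrite fibSS addn_gt0 IH.
Qed.

(** Both sides obey the Fibonacci recurrence in [i], so the induction carries two consecutive
    values. *)
Lemma lucas_addn k i :
  lucas (k + 2 + i) = (lucas k * fib i.+1 + lucas k.+1 * fib i.+2)%N.
Proof.
suff: lucas (k + 2 + i) = (lucas k * fib i.+1 + lucas k.+1 * fib i.+2)%N /\
      lucas (k + 2 + i).+1 = (lucas k * fib i.+2 + lucas k.+1 * fib i.+3)%N.
  by case.
elim: i => [|i [IH1 IH2]].
  by rewrite addn0 addn2 !lucasSS /=; lia.
rewrite addnS; split=> //.
by rewrite lucasSS IH1 IH2 (fibSS i.+2) (fibSS i.+1) (fibSS i); lia.
Qed.

Lemma psum_lucas_addn k p m :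
  psum (fun i => lucas (k + 2 + i)) p m =
  (lucas k * psum (fun i => fib i.+1) p m
   + lucas k.+1 * psum (fun i => fib i.+2) p m)%N.
Proof.
elim: m => [|m IH]; first by rewrite !psum0 !muln0.
by rewrite !psumS IH; case: (p m); rewrite ?lucas_addn; lia.
Qed.

(** * Uniqueness and existence of representations *)

(** If the top index is used, the one below it is not, and induction bounds the rest. The bound
    starts at L_2, since L_0 alone exceeds L_1; excluding L_0 + L_2 gives the case of L_3. *)
Lemma psum_lucas_lt p m :
  lucas_admissible p -> (psum lucas p m.+2 < lucas m.+2)%N.
Proof.
move=> [nc n02]; elim/ltn_ind: m => -[|[|m]] IH.
- rewrite !psumS psum0; have := nc 0%N.
  by case: (p 0%N); case: (p 1%N).
- rewrite !psumS psum0; have := nc 0%N; have := nc 1%N; move: n02.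
  by case: (p 0%N); case: (p 1%N); case: (p 2).
- rewrite psumS; case: ifP => pm.
    have pm1 : p m.+2 = false by apply/negP => h; have := nc m.+2; rewrite h pm.
    rewrite psumS pm1 addn0 (lucasSS m.+2).
    by have := IH m (ltnW (ltnSn _)); lia.
  rewrite addn0 (lucasSS m.+2); have := IH m.+1 (ltnSn _); lia.
Qed.

(** By [psum_lucas_lt] the sum itself tells whether the top index is used; cancel it and descend. *)
Lemma psum_lucas_inj p q m :
  lucas_admissible p -> lucas_admissible q ->
  psum lucas p m = psum lucas q m -> forall i, (i < m)%N -> p i = q i.
Proof.
move=> Vp Vq; elim: m => [//|m IH] eqpq.
suff pqm : p m = q m.
  move: eqpq; rewrite !psumS pqm => /addIn /IH {}IH i.
  by rewrite ltnS leq_eqVlt => /orP[/eqP->|/IH].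
case: m {IH} eqpq => [|[|m]].
- by rewrite !psumS !psum0; case: (p 0%N); case: (q 0%N).
- rewrite !psumS !psum0; have [/(_ 0%N) + _] := Vp; have [/(_ 0%N) + _] := Vq.
  by case: (p 0%N); case: (q 0%N); case: (p 1%N); case: (q 1%N).
- rewrite !(psumS _ _ m.+2).
  have := psum_lucas_lt m Vp; have := psum_lucas_lt m Vq.
  by case: (p m.+2); case: (q m.+2) => //; lia.
Qed.

Definition padd (a : nat) (p : pred nat) : pred nat := fun i => (i == a) || p i.

Lemma psum_padd c p a m :
  supported_below p a -> (a < m)%N ->
  psum c (padd a p) m = (psum c p a + c a)%N.
Proof.
move=> pa; elim: m => // m IH; rewrite ltnS leq_eqVlt psumS => /orP[/eqP<-|am].
  rewrite /padd eqxx; congr addn; apply: eq_psum => // i ia.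
  by rewrite ltn_eqF.
rewrite IH // /padd gtn_eqF //=.
by case: ifP => [/pa|]; [lia | rewrite addn0].
Qed.

Lemma psum_supported c p a m :
  supported_below p a -> (a <= m)%N -> psum c p m = psum c p a.
Proof.
move=> pa; elim: m => [|m IH]; first by rewrite leqn0 => /eqP->.
rewrite leq_eqVlt => /orP[/eqP->//|]; rewrite ltnS psumS => am.
by rewrite IH //; case: ifP => [/pa|]; [lia | rewrite addn0].
Qed.

Lemma nonconsecutive_padd p a :
  nonconsecutive p -> supported_below p a -> nonconsecutive (padd a.+1 p).
Proof.
move=> nc pa i; rewrite /padd; have := nc i; have := pa i; have := pa i.+1.
by case: (p i); case: (p i.+1) => //=; lia.
Qed.

(** Greedy choice: once the largest possible Lucas number is subtracted, the remainder is so small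
    that its indices stay clear of the neighbouring one. *)
Lemma lucas_representation m N : (N < lucas m.+2)%N ->
  exists p, [/\ lucas_admissible p, supported_below p m.+2
              & psum lucas p m.+2 = N].
Proof.
have pad0 a : (a < 3)%N -> lucas_admissible (pred1 a).
  by move=> a3; split=> [i|] /=; lia.
elim/ltn_ind: m N => -[|m] IH N ltN.
  case: N ltN => [|[|[|//]]] _.
  - by exists pred0; split; rewrite ?psumS ?psum0.
  - exists (pred1 1%N); split; rewrite ?psumS ?psum0 //; first exact: pad0.
    by move=> i /eqP->.
  - exists (pred1 0%N); split; rewrite ?psumS ?psum0 //; first exact: pad0.
    by move=> i /eqP->.
have [ltN'|leN] := ltnP N (lucas m.+2).
  have [p [Vp pm Sp]] := IH m (ltnSn _) N ltN'.
  exists p; split=> //; first by move=> i /pm; lia.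
  by rewrite (@psum_supported _ _ m.+2).
(* Here [N] is 3, represented by L_2 alone; all later top indices are at least 3 and cannot create
   the pair 0, 2. *)
case: m IH ltN leN => [|m] IH ltN leN.
  exists (pred1 2); split; first exact: pad0.
    by move=> i /eqP->.
  by move: ltN leN; rewrite !psumS psum0 /=; lia.
have ltN' : (N - lucas m.+3 < lucas m.+2)%N.
  by move: ltN; rewrite (lucasSS m.+2); have := lucas_gt0 m.+2; lia.
have [p [[nc n02] pm Sp]] := IH m (ltnW (ltnSn _)) _ ltN'.
have pm' : supported_below p m.+3 by move=> i /pm; lia.
exists (padd m.+3 p); split.
- by split; [exact: nonconsecutive_padd | rewrite /padd].
- by move=> i /orP[/eqP->//|/pm']; lia.
- by rewrite psum_padd // (@psum_supported _ _ m.+2) // Sp; lia.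
Qed.

(* The predicate p is read as the index set {i + 2 | p i}. *)
Lemma zeckendorf m n : (n < fib m.+2)%N ->
  exists p, [/\ nonconsecutive p, supported_below p m
              & psum (fun i => fib i.+2) p m = n].
Proof.
elim/ltn_ind: m n => -[|m] IH n ltn.
  by exists pred0; split; rewrite ?psum0 //; case: n ltn.
have [ltn'|len] := ltnP n (fib m.+2).
  have [p [Vp pm Sp]] := IH m (ltnSn _) n ltn'.
  exists p; split=> //; first by move=> i /pm; lia.
  by rewrite (@psum_supported _ _ m).
case: m IH ltn len => [|m] IH ltn len.
  exists (pred1 0%N); split; first by move=> i /=; lia.
    by move=> i /eqP->.
  by move: ltn len; rewrite !psumS psum0 /=; lia.
have ltn' : (n - fib m.+3 < fib m.+2)%N.
  move: ltn; rewrite (fibSS m.+2); lia.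
have [p [nc pm Sp]] := IH m (ltnW (ltnSn _)) _ ltn'.
have pm' : supported_below p m.+1 by move=> i /pm; lia.
exists (padd m.+1 p); split.
- exact: nonconsecutive_padd.
- by move=> i /orP[/eqP->//|/pm']; lia.
- by rewrite psum_padd // (@psum_supported _ _ m) // Sp; lia.
Qed.

(** * From predicates back to finite sets *)

Lemma lucas_partitionP N (I : {fset nat}) m :
  supported_below (mem I) m ->
  lucas_partition N I <-> lucas_admissible (mem I) /\ N = psum lucas (mem I) m.
Proof.
move=> Im; rewrite /lucas_partition (psum_fset lucas Im).
split=> [[NE nc n02]|[[nc n02] NE]]; split=> //.
- by split=> [i|]; apply/negP => /andP[? ?]; [apply: (nc i) | apply: n02].
- by move=> i [iI iI']; have := nc i; rewrite /= iI iI'.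
- by move=> [iI iI']; move: n02; rewrite /= iI iI'.
Qed.

Lemma exists_fset_mem p m :
  supported_below p m -> exists I : {fset nat}, forall i, (i \in I) = p i.
Proof.
move=> pm; exists [fset i | i in iota 0 m & p i]%fset => i.
rewrite !inE /= mem_iota /= add0n andb_idl //; exact: pm.
Qed.

Lemma lucas_admissible_eq p q : p =1 q -> lucas_admissible p -> lucas_admissible q.
Proof. by move=> pq [nc n02]; split=> [i|]; rewrite -!pq. Qed.

Lemma lucas_partition_unique N : (0 < N)%N ->
  exists! I : {fset nat}, lucas_partition N I.
Proof.
move=> _; have [p [Vp pm Sp]] := @lucas_representation N N (ltn_lucas N).
have [I IE] := exists_fset_mem pm.
have Im : supported_below (mem I) N.+2 by move=> i; rewrite /= IE; apply: pm.
exists I; split.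
  apply/(lucas_partitionP _ Im); split; last first.
    by rewrite -[LHS]Sp; apply: eq_psum => // i _; rewrite /= IE.
  by apply: lucas_admissible_eq Vp => i /=; rewrite IE.
move=> J; have [m Jm] := fset_supported_below J.
(* Injectivity compares sums over one range, so both sets get a common bound. *)
have Jm' : supported_below (mem J) (m + N.+2) by move=> i /Jm; lia.
have Im' : supported_below (mem I) (m + N.+2) by move=> i /Im; lia.
move=> /(lucas_partitionP _ Jm') [VJ NJ]; apply/fsetP => i.
have VI : lucas_admissible (mem I).
  by apply: lucas_admissible_eq Vp => i0 /=; rewrite IE.
have NI : psum lucas (mem I) (m + N.+2) = N.
  rewrite (psum_supported lucas Im) ?leq_addl // -[RHS]Sp.
  by apply: eq_psum => // x _; rewrite /= IE.
have [im|im] := ltnP i (m + N.+2).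
  by apply: (psum_lucas_inj VI VJ _ im); rewrite NI.
by apply/idP/idP => [/Im'|/Jm']; lia.
Qed.

(** * Splitting a partition at a given summand *)

Lemma lucas_summand_setP k N :
  lucas_summand_set k N <->
  exists p m, [/\ lucas_admissible p, supported_below p m, p k
                & N = psum lucas p m].
Proof.
split=> [[_ [I [+ kI]]]|[p [m [Vp pm pk NE]]]].
  have [m Im] := fset_supported_below I.
  by move=> /(lucas_partitionP _ Im) [VI NE]; exists (mem I), m.
split.
  rewrite NE -(subnKC (pm _ pk)) psum_addn psumS pk.
  by have := lucas_gt0 k; lia.
have [I IE] := exists_fset_mem pm.
have Im : supported_below (mem I) m by move=> i; rewrite /= IE; apply: pm.
exists I; rewrite IE; split=> //; apply/(lucas_partitionP _ Im); split.
  by apply: lucas_admissible_eq Vp => i /=; rewrite IE.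
by rewrite NE; apply: eq_psum => // i _; rewrite /= IE.
Qed.


(* For K = 0 there is no index below K, whence the bound 1 instead of L_0 = 2. *)
Lemma lucas_summand_setS K N :
  lucas_summand_set K.+1 N <->
  exists j, (j < if K is 0%N then 1 else lucas K)%N /\
    exists q m, [/\ nonconsecutive q, supported_below q m
      & N = (j + lucas K.+1 + psum (fun i => lucas (K.+1 + 2 + i)) q m)%N].
Proof.
split=> [/lucas_summand_setP [p [m [[nc n02] pm pK NE]]]|].
  exists (psum lucas p K); split.
    (* For [K = 1] the summand is L_2, which excludes index 0, so the lower part is empty. *)
    case: K pK {NE} => [|[|K]] pK; first by rewrite psum0.
      by rewrite psumS psum0; move: n02; rewrite pK andbT => /negPf->.
    exact: psum_lucas_lt.
  exists (fun i => p (K.+1 + 2 + i)%N), m; split.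
  - by move=> i; rewrite [(_ + i.+1)%N]addnS; apply: nc.
  - by move=> i /pm; lia.
  - have pK0 : p K = false by have := nc K; rewrite pK andbT => /negPf.
    have pK2 : p K.+2 = false by have := nc K.+1; rewrite pK => /negPf.
    rewrite NE -(psum_supported lucas pm (leq_addl (K.+1 + 2) m)) psum_addn.
    by rewrite addn2 !psumS pK0 pK2 pK !addn0.
move=> [j [jK [q [m [nq qm NE]]]]]; apply/lucas_summand_setP.
(* [r] holds the indices below [K]; the last clause prevents 0 from joining 2 when [K = 1]. *)
have [r [[nr r02] rK Sr r0]] : exists r, [/\ lucas_admissible r,
    supported_below r K, psum lucas r K = j & (K <= 1)%N -> ~~ r 0%N].
  case: K jK {NE} => [|[|K]] jK; last first.
    by have [r [? ? ?]] := lucas_representation jK; exists r.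
  - by exists pred0; split; rewrite // psumS psum0; case: j jK.
  - by exists pred0; split; rewrite // psum0; case: j jK.
(* Glue [r], the index [K.+1] and the shifted [q], leaving gaps at [K] and [K.+2]. *)
pose p i := if (i < K)%N then r i
            else (i == K.+1) || (K.+1 + 2 <= i)%N && q (i - (K.+1 + 2))%N.
have pq i : p (K.+1 + 2 + i)%N = q i.
  by rewrite /p addKn leq_addr; case: ifP; first lia; case: eqP => //; lia.
exists p, (K.+1 + 2 + m)%N; split.
- split=> [i|].
    rewrite /p; have := nr i.
    have [le|gt] := leqP (K.+1 + 2) i.
      have := nq (i - (K.+1 + 2))%N; rewrite -subSn //.
      by case: ifP; [lia|]; case: ifP; [lia|]; case: eqP; [lia|]; case: eqP; lia.
    case: ifP; case: ifP => //=; try lia.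
  rewrite /p; case: K {jK NE Sr rK pq p} r0 => [|[|[|K]]] r0 //=; last by rewrite andbF.
  by rewrite (negPf (r0 isT)).
- move=> i; have [le|gt] := leqP (K.+1 + 2) i; last by lia.
  by rewrite -(subnKC le) pq => /qm; lia.
- by rewrite /p ltnNge leqnSn /= eqxx.
- rewrite psum_addn addn2 !psumS NE; congr (_ + _)%N; last first.
    by apply: eq_psum => [x _|x]; rewrite -?pq addn2.
  have -> : psum lucas p K = j by rewrite -Sr; apply: eq_psum => // i; rewrite /p => ->.
  have -> : p K = false by rewrite /p ltnn; lia.
  have -> : p K.+1 by rewrite /p ltnNge leqnSn /= eqxx.
  have -> : p K.+2 = false by rewrite /p; case: ifP; lia.
  by rewrite !addn0.
Qed.

(** The offset is written [1 + 2 + i] so that the tail is the one belonging to L_1. *)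
Lemma lucas_summand_set0 N :
  lucas_summand_set 0 N <->
  exists q m, [/\ nonconsecutive q, supported_below q m
    & N = (2 + psum (fun i => lucas (1 + 2 + i)) q m)%N].
Proof.
split=> [/lucas_summand_setP [p [m [[nc n02] pm p0 NE]]]|[q [m [nq qm NE]]]].
  exists (fun i => p (1 + 2 + i)%N), m; split.
  - by move=> i; rewrite [(_ + i.+1)%N]addnS; apply: nc.
  - by move=> i /pm; lia.
  - have p1 : p 1%N = false by have := nc 0%N; rewrite p0 => /negPf.
    have p2 : p 2 = false by move: n02; rewrite p0 => /negPf.
    rewrite NE -(psum_supported lucas pm (leq_addl (1 + 2) m)) psum_addn.
    by rewrite !psumS psum0 p0 p1 p2.
apply/lucas_summand_setP.
exists (fun i => (i == 0%N) || (2 < i)%N && q (i - 3)%N), (1 + 2 + m)%N; split=> //.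
- by split=> // -[|[|[|i]]] //=; rewrite !subSS !subn0; apply: nq.
- by move=> [|[|[|i]]] //=; rewrite !subSS subn0 => /qm; lia.
- rewrite NE psum_addn !psumS psum0; congr addn.
  by apply: eq_psum => // i _; rewrite addKn.
Qed.

(** * The golden ratio and the floor formula *)

Lemma golden_ratio_sqr (R : realType) :
  golden_ratio R ^+ 2 = golden_ratio R + 1.
Proof.
have s5 : Num.sqrt 5 ^+ 2 = 5 :> R by rewrite sqr_sqrtr.
by rewrite /golden_ratio; field: s5.
Qed.

Lemma golden_ratio_gt0 (R : realType) : 0 < golden_ratio R.
Proof. by rewrite /golden_ratio divr_gt0 // ltr_pwDl ?sqrtr_ge0. Qed.

Lemma golden_ratio_inv (R : realType) :
  (golden_ratio R)^-1 = golden_ratio R - 1.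
Proof.
have Phi0 := lt0r_neq0 (golden_ratio_gt0 R).
apply: (mulfI Phi0); rewrite divff //.
by have := golden_ratio_sqr R; nra.
Qed.

Lemma golden_ratio_gt1 (R : realType) : 1 < golden_ratio R.
Proof. by rewrite -subr_gt0 -golden_ratio_inv invr_gt0 golden_ratio_gt0. Qed.

(** 1 - Phi is the other root of x^2 = x + 1, so both sides satisfy the Fibonacci recurrence. *)
Lemma fib_conjugate (R : realType) i :
  (fib i.+1)%:R - (fib i.+2)%:R / golden_ratio R
  = (1 - golden_ratio R) ^+ i.+2 :> R.
Proof.
have Phi2 := golden_ratio_sqr R; rewrite golden_ratio_inv.
elim/ltn_ind: i => -[|[|i]] IH.
- by rewrite /=; ring: Phi2.
- by rewrite /=; ring: Phi2.
- have -> : (1 - golden_ratio R) ^+ i.+4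
          = (1 - golden_ratio R) ^+ i.+3 + (1 - golden_ratio R) ^+ i.+2.
    by rewrite (exprS _ i.+3) (exprS _ i.+2); ring: Phi2.
  rewrite -(IH i.+1 (ltnSn _)) -(IH i (ltnW (ltnSn _))).
  by rewrite (fibSS i.+2) (fibSS i.+1) !natrD; ring.
Qed.

(* The terms with even exponents sum to less than 1 / (1 - Phi^-2) = Phi, and
   those with odd exponents to more than - Phi^-1 / (1 - Phi^-2) = -1. *)
Lemma conjugate_sum_bounds (R : realType) (p : pred nat) m :
  -1 < \sum_(i < m) (if p i then (1 - golden_ratio R) ^+ i else 0)
     < golden_ratio R.
Proof.
have Phi1 := golden_ratio_gt1 R; have Phi2 := golden_ratio_sqr R.
elim: m p => [|m IH] p; first by rewrite big_ord0; lra.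
rewrite big_ord_recl /= expr0.
have /andP[] := IH (fun i => p i.+1).
set E := \sum_(i < m) _ => E1 E2.
have -> : \sum_(i < m) (if p (bump 0 i) then (1 - golden_ratio R) ^+ bump 0 i else 0)
          = (1 - golden_ratio R) * E.
  rewrite /E mulr_sumr; apply: eq_bigr => i _.
  by rewrite /bump /= add1n exprS; case: ifP; rewrite ?mulr0.
(* From -1 < E < Phi, the product (1 - Phi) E lies strictly between -1 and Phi - 1; adding 0 or 1
   keeps the bounds. *)
have P1 : 0 < (golden_ratio R - 1) * (E + 1) by apply: mulr_gt0; lra.
have P2 : 0 < (golden_ratio R - 1) * (golden_ratio R - E) by apply: mulr_gt0; lra.
by case: (p 0%N); nra.
Qed.

Lemma floor_zeckendorf (R : realType) (q : pred nat) m :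
  Num.floor (((psum (fun i => fib i.+2) q m)%:R + 1) / golden_ratio R)
  = (psum (fun i => fib i.+1) q m)%:Z.
Proof.
have Phi1 := golden_ratio_gt1 R; have Phi2 := golden_ratio_sqr R.
have /andP[] := conjugate_sum_bounds R q m.
set E := \sum_(i < m) _ => E1 E2.
have hE : (psum (fun i => fib i.+1) q m)%:R
          - (psum (fun i => fib i.+2) q m)%:R / golden_ratio R
          = (1 - golden_ratio R) ^+ 2 * E.
  rewrite /E /psum !big_mkord !natr_sum mulr_suml -sumrB mulr_sumr.
  apply: eq_bigr => i _; case: ifP => _; last by rewrite mul0r subr0 mulr0.
  by rewrite fib_conjugate -exprD.
apply: floor_def; rewrite intrD -!pmulrn mulrDl mul1r.
(* Scaling -1 < E < Phi by (1 - Phi)^2 gives the strict bounds Phi - 2 = 1 / Phi - 1 and Phi - 1 = 1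
   / Phi. *)
have P1 : 0 < (1 - golden_ratio R) ^+ 2 * (E + 1).
  by apply: mulr_gt0; [rewrite exprn_even_gt0 //=; lra | lra].
have P2 : 0 < (1 - golden_ratio R) ^+ 2 * (golden_ratio R - E).
  by apply: mulr_gt0; [rewrite exprn_even_gt0 //=; lra | lra].
have b2 : (1 - golden_ratio R) ^+ 2 = 2 - golden_ratio R by ring: Phi2.
have b2P : (1 - golden_ratio R) ^+ 2 * golden_ratio R = golden_ratio R - 1.
  by ring: Phi2.
rewrite mulrDr mulr1 b2 in P1; rewrite mulrBr b2P b2 in P2.
by rewrite golden_ratio_inv b2 in hE *; apply/andP; split; lra.
Qed.

(** As Phi^2 = Phi + 1, the argument grows by exactly 1; this accounts for the summand L_k
    itself. *)
Lemma floor_golden_ratio_sqr (R : realType) (x : R) :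
  Num.floor ((x + golden_ratio R ^+ 2) / golden_ratio R)
  = Num.floor ((x + 1) / golden_ratio R) + 1.
Proof.
rewrite golden_ratio_sqr addrCA mulrDl divff ?lt0r_neq0 ?golden_ratio_gt0 //.
by rewrite [1 + _]addrC floorDrz // floor1.
Qed.

(** * Tails as floor formulas, and the three cases *)

(** Common to all cases: [c] collects what precedes the tail. *)
Lemma lucas_tailP (R : realType) k c N :
  (exists q m, [/\ nonconsecutive q, supported_below q m
     & N = (c + psum (fun i => lucas (k + 2 + i)) q m)%N]) <->
  exists n : nat, N%:Z = c%:Z
    + (lucas k)%:Z * Num.floor ((n%:R + 1) / golden_ratio R)
    + n%:Z * (lucas k.+1)%:Z.
Proof.
split=> [[q [m [_ _ ->]]]|[n NE]].
  exists (psum (fun i => fib i.+2) q m).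
  by rewrite floor_zeckendorf psum_lucas_addn; lia.
have [q [nq qm Sq]] := zeckendorf (ltn_fib n).
exists q, n; split=> //.
by move: NE; rewrite -{1}Sq floor_zeckendorf psum_lucas_addn Sq; lia.
Qed.

Theorem theorem1p4 (R : realType) :
  let Phi : R := golden_ratio R in
  (forall N : nat, (0 < N)%N ->
     exists! I : {fset nat}, lucas_partition N I) /\
  (forall k : nat,
     [/\ k = 0%N ->
           lucas_summand_set k =
           [set N : nat | exists n : nat,
              N%:Z = 2 + 3 * n%:Z + Num.floor ((n%:R + 1) / Phi)],
         k = 1%N ->
           lucas_summand_set k =
           [set N : nat | exists n : nat,
              N%:Z = 3 * n%:Z + Num.floor ((n%:R + Phi ^+ 2) / Phi)]
       & (2 <= k)%N ->
           lucas_summand_set k =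
           [set N : nat | exists n j : nat,
              (j%:Z <= (lucas (k - 1))%:Z - 1) /\
              N%:Z = (lucas k)%:Z * Num.floor ((n%:R + Phi ^+ 2) / Phi)
                     + n%:Z * (lucas (k + 1))%:Z + j%:Z]]).
Proof.
move=> Phi; split; first exact: lucas_partition_unique.
move=> k; split=> [->|->|].
- apply/seteqP; split=> N /=.
    (* The tail from L_3 is expanded in L_1 = 1 and L_2 = 3, after the constant L_0 = 2. *)
    move=> /lucas_summand_set0/(lucas_tailP R 1 2 N) [n NE].
    by exists n; rewrite NE /= /Phi; lia.
  move=> [n NE]; apply/lucas_summand_set0/(lucas_tailP R 1 2 N).
  by exists n; rewrite NE /= /Phi; lia.
- apply/seteqP; split=> N /=.
    move=> /lucas_summand_setS [j [j0 /(lucas_tailP R 1 _ N) [n NE]]].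
    have {}j0 : j = 0%N by case: j j0 {NE}.
    by exists n; rewrite NE j0 /Phi floor_golden_ratio_sqr mul1r /=; ring.
  move=> [n NE]; apply/lucas_summand_setS; exists 0%N; split=> //.
  apply/(lucas_tailP R 1 _ N).
  by exists n; rewrite NE /Phi floor_golden_ratio_sqr /=; ring.
- case: k => [//|[//|K]] _; rewrite subn1 addn1 -[K.+2.-1]/K.+1.
  apply/seteqP; split=> N.
    move=> /lucas_summand_setS [j [jK /(lucas_tailP R K.+2 _ N) [n NE]]].
    have {}jK : (j < lucas K.+1)%N by [].
    exists n, j; split; first by lia.
    by rewrite NE /Phi floor_golden_ratio_sqr PoszD; ring.
  move=> [n [j [jK NE]]]; apply/lucas_summand_setS; exists j; split.
    by rewrite -[X in (_ < X)%N]/(lucas K.+1); lia.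
  apply/(lucas_tailP R K.+2 _ N).
  by exists n; rewrite NE /Phi floor_golden_ratio_sqr PoszD; ring.
Qed.
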